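(* Let $\mathbb{K}$ be a field of characteristic zero and $\ell : \mathbb{N}-\{0\} \to \mathbb{K}^\times$ a monoid homomorphism. The composition operation on $\mathbb{K}_\sigma\mathcal{B}$ is associative, $\mathbb{K}_\sigma\mathcal{B}$ is a $\mathbb{K}$-linear category, and the maps $\nu^{F,G}$, for finite groups $F$ and $G$, determine an isomorphism of $\mathbb{K}$-linear categories $\nu:\mathbb{K}_\sigma\mathcal{B}\to\overline{\mathbb{K}_\sigma\mathcal{S}}$ that acts on objects as the identity.
   Context: Throughout $F,G,H$ are finite groups. Elements of $F\times G$ are written $f\times g$, and $\mathcal{S}(F,G)$ is the set of subgroups of $F\times G$. For $U\in\mathcal{S}(F,G)$, put $U_\bullet=\{g\in G: 1\times g\in U\}$, ${}_\bullet U=\{f\in F: f\times 1\in U\}$, and let ${}^\bullet U\leq F$ and $U^\bullet\leq G$ be the images of $U$ under the projections. For $U\in\mathcal{S}(F,G)$, $V\in\mathcal{S}(G,H)$, the star product $U*V\in\mathcal{S}(F,H)$ is the subgroup of those $f\times h$ for which there exists $g\in G$ with $f\times g\in U$ and $g\times h\in V$. Put $\sigma(U,V)=\ell(U_\bullet\cap{}_\bullet V)$, where $\ell(A)$ means $\ell(|A|)$ for a finite group $A$. Left superscripts denote conjugation (${}^gx=gxg^{-1}$). For a $\mathbb{K}$-linear category $\mathcal{C}$, $\mathcal{C}(F,G)$ denotes the $\mathbb{K}$-module of morphisms from $G$ to $F$. $\mathbb{K}_\sigma\mathcal{S}$ is the $\mathbb{K}$-linear category whose objects are the finite groups, with $\mathbb{K}_\sigma\mathcal{S}(F,G)$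 having $\mathbb{K}$-basis $\{s_U^{F,G}:U\in\mathcal{S}(F,G)\}$ and composition $s_U^{F,G}s_V^{G,H}=\sigma(U,V)s_{U*V}^{F,H}$ (this is associative, with identity $s_{\Delta(G)}^{G,G}$ on $G$, $\Delta(G)=\{g\times g:g\in G\}$). $F\times G$ acts on $\mathbb{K}_\sigma\mathcal{S}(F,G)$ by ${}^{f\times g}s_U^{F,G}=s_{{}^{f\times g}U}^{F,G}$. Put $$\overline{s}_U^{F,G}=\frac{1}{|F|\,|G|}\sum_{f\in F,\,g\in G}s_{{}^{f\times g}U}^{F,G},$$ which depends only on the $F\times G$-conjugacy class of $U$. $\overline{\mathbb{K}_\sigma\mathcal{S}}$ is the $\mathbb{K}$-linear category whose objects are the finite groups, with morphisms $\overline{\mathbb{K}_\sigma\mathcal{S}}(F,G)=(\mathbb{K}_\sigma\mathcal{S}(F,G))^{F\times G}$ (the fixed submodule), which has as $\mathbb{K}$-basis the elements $\overline{s}_U^{F,G}$ as $U$ runs over representatives of the conjugacy classes of subgroups of $F\times G$; composition is that of $\mathbb{K}_\sigma\mathcal{S}$, and the identity morphism on $G$ is $\overline{s}_{\Delta(G)}^{G,G}$. $\mathbb{K}_\sigma\mathcal{B}$ is the following structure. Its objects are the finite groups. The morphism $\mathbb{K}$-module $\mathbb{K}_\sigma\mathcal{B}(F,G)$ has a formal $\mathbb{K}$-basis of elements $d_U^{F,G}$, with $U$ running over representatives of the conjugacy classes of subgroups of $F\times G$ (and $d_U^{F,G}=d_{U'}^{F,G}$ for conjugate $U,U'$). The composition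 is $\mathbb{K}$-bilinear with $$d_U^{F,G}d_V^{G,H}=\sum_{U^\bullet g\,{}^\bullet V\subseteq G}\frac{\ell(U_\bullet\cap{}^g({}_\bullet V))}{|U_\bullet\cap{}^g({}_\bullet V)|}\,d_{U*{}^{g\times1}V}^{F,H},$$ where $g$ runs over representatives of the double cosets of $U^\bullet$ and ${}^\bullet V$ in $G$ (this is well defined). The proposed identity morphism on $G$ is $d_{\Delta(G)}^{G,G}$. The map $\nu^{F,G}:\mathbb{K}_\sigma\mathcal{B}(F,G)\to\overline{\mathbb{K}_\sigma\mathcal{S}}(F,G)$ is the $\mathbb{K}$-linear isomorphism with $\nu^{F,G}(d_U^{F,G})=|G|\,\overline{s}_U^{F,G}/|U|$. *)

(* Defs.v *)
From HB Require Import structures.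
From mathcomp Require Import all_boot all_order all_algebra all_fingroup.

Set Implicit Arguments.
Unset Strict Implicit.
Unset Printing Implicit Defensive.

Import GRing.Theory.
Local Open Scope ring_scope.

(** [hom C F G] is the module of morphisms from [G] to [F], so that
    [cmp x y] is "[x] after [y]". *)
Record lincat_data (K : fieldType) := LincatData {
  obj : Type;
  hom : obj -> obj -> lmodType K;
  cmp : forall F G H : obj, hom F G -> hom G H -> hom F H;
  idm : forall G : obj, hom G G
}.
Arguments cmp {K C F G H} : rename.
Arguments idm {K C} G : rename.

Definition cmp_associative (K : fieldType) (C : lincat_data K) : Prop :=
  forall (E F G H : obj C) (x : hom E F) (y : hom F G) (z : hom G H),
    cmp (cmp x y) z = cmp x (cmp y z).

Record is_lincat (K : fieldType) (C : lincat_data K) : Prop := IsLincat {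
  lincat_assoc : cmp_associative C;
  lincat_id_l : forall (F G : obj C) (x : hom F G), cmp (idm F) x = x;
  lincat_id_r : forall (F G : obj C) (x : hom F G), cmp x (idm G) = x;
  lincat_lin_l : forall (F G H : obj C) (y : hom G H),
    linear (fun x : hom F G => cmp x y);
  lincat_lin_r : forall (F G H : obj C) (x : hom F G),
    linear (fun y : hom G H => cmp x y)
}.

Record functor_data (K : fieldType) (C D : lincat_data K) := FunctorData {
  fobj : obj C -> obj D;
  fmor : forall F G : obj C, hom F G -> hom (fobj F) (fobj G)
}.
Arguments fmor {K C D} T {F G} : rename.

Record is_linfunctor (K : fieldType) (C D : lincat_data K)
    (T : functor_data C D) : Prop := IsLinfunctor {
  linfunctor_lin : forall F G : obj C, linear (@fmor K C D T F G);
  linfunctor_cmp : forall (F G H : obj C) (x : hom F G) (y : hom G H),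
    fmor T (cmp x y) = cmp (fmor T x) (fmor T y);
  linfunctor_id : forall G : obj C, fmor T (idm G) = idm (fobj T G)
}.

Definition id_functor (K : fieldType) (C : lincat_data K) : functor_data C C :=
  @FunctorData K C C id (fun F G x => x).

Definition comp_functor (K : fieldType) (C D E : lincat_data K)
    (S : functor_data D E) (T : functor_data C D) : functor_data C E :=
  @FunctorData K C E (fun G => fobj S (fobj T G))
    (fun F G x => fmor S (fmor T x)).

Definition is_lincat_iso (K : fieldType) (C D : lincat_data K)
    (T : functor_data C D) : Prop :=
  [/\ is_lincat C, is_lincat D, is_linfunctor T
    & exists S : functor_data D C,
        [/\ is_linfunctor S, comp_functor S T = id_functor C
          & comp_functor T S = id_functor D]].

(** Monoid homomorphisms from the positive integers to the group of units
    of [K]; the value at [0] is irrelevant, as [l] is only ever applied to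
    orders of finite groups. *)
Record pos_monoid_hom (K : fieldType) (l : nat -> K) : Prop := PosMonoidHom {
  pmh_unit : forall n, (0 < n)%N -> l n != 0;
  pmh_1 : l 1%N = 1;
  pmh_mul : forall m n, (0 < m)%N -> (0 < n)%N -> l (m * n)%N = l m * l n
}.

(** The left conjugate [a U a^-1]; recall that [U :^ a] is [a^-1 U a]. *)
Definition lconj (gT : finGroupType) (a : gT) (U : {group gT}) : {group gT} :=
  (U :^ a^-1)%G.

Section Subgroups.
Variables F G H : finGroupType.
Implicit Types (U : {group F * G}) (V : {group G * H}).

(** For [U <= F x G], with left/right for the side of the bullet decoration:
    [lbot U] and [rbot U] are the lower-bullet groups (kernels of the opposite
    projections), [ltop U] and [rtop U] the upper-bullet ones (projections). *)
Definition lbot U : {set F} := [set f | (f, 1%g) \in U].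
Definition rbot U : {set G} := [set g | (1%g, g) \in U].
Definition ltop U : {set F} := [set u.1 | u in U].
Definition rtop U : {set G} := [set u.2 | u in U].

Definition star_set U V : {set F * H} :=
  [set w | [exists g : G, ((w.1, g) \in U) && ((g, w.2) \in V)]].

Lemma star_group_set U V : group_set (star_set U V).
Proof.
apply/group_setP; split=> [|[f h] [f' h']].
  by rewrite inE; apply/existsP; exists 1%g; rewrite !group1.
rewrite !inE /= => /existsP[g /andP[Ug Vg]] /existsP[g' /andP[Ug' Vg']].
apply/existsP; exists (g * g')%g.
by rewrite (groupM Ug Ug') (groupM Vg Vg').
Qed.

Canonical star U V := group (star_group_set U V).

End Subgroups.

Definition diag_set (G : finGroupType) : {set G * G} := [set u | u.1 == u.2].

Lemma diag_group_set (G : finGroupType) : group_set (diag_set G).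
Proof.
apply/group_setP; split=> [|[g g'] [k k']]; first by rewrite inE.
by rewrite !inE /= => /eqP-> /eqP->.
Qed.

Canonical diag (G : finGroupType) := group (diag_group_set G).

Section SubgroupsTheory.
Variables F G H : finGroupType.
Implicit Types (U : {group F * G}) (V : {group G * H}).

Lemma mem_lconj (gT : finGroupType) (a u : gT) (U : {group gT}) :
  (u \in lconj a U) = ((u ^ a)%g \in U).
Proof. by rewrite mem_conjgV. Qed.

Lemma lconjM (gT : finGroupType) (a b : gT) (U : {group gT}) :
  lconj a (lconj b U) = lconj (a * b)%g U.
Proof. by apply/group_inj/setP=> u; rewrite !mem_lconj conjgM. Qed.

Lemma lconj1 (gT : finGroupType) (U : {group gT}) : lconj 1%g U = U.
Proof. by apply/group_inj/setP=> u; rewrite mem_lconj conjg1. Qed.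

Lemma lconj_mem (gT : finGroupType) (a : gT) (U : {group gT}) :
  a \in U -> lconj a U = U.
Proof. by move=> Ua; apply/group_inj; rewrite /= conjGid ?groupV. Qed.

Lemma lconjK (gT : finGroupType) (a : gT) :
  cancel (lconj a) (lconj (gT := gT) a^-1%g).
Proof. by move=> U; rewrite lconjM mulVg lconj1. Qed.

Lemma lconjKV (gT : finGroupType) (a : gT) :
  cancel (lconj (gT := gT) a^-1%g) (lconj a).
Proof. by move=> U; rewrite lconjM mulgV lconj1. Qed.

Lemma lconj_inj (gT : finGroupType) (a : gT) : injective (lconj a).
Proof. exact: can_inj (lconjK a). Qed.

Lemma card_lconj (gT : finGroupType) (a : gT) (U : {group gT}) :
  #|lconj a U| = #|U|.
Proof. exact: cardJg. Qed.

Lemma pairMg (gT hT : finGroupType) (f f' : gT) (g g' : hT) :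
  ((f, g) * (f', g') = (f * f', g * g'))%g.
Proof. by []. Qed.

Lemma pairVg (gT hT : finGroupType) (f : gT) (g : hT) :
  ((f, g)^-1 = (f^-1, g^-1))%g.
Proof. by []. Qed.

Lemma pairJg (gT hT : finGroupType) (f f' : gT) (g g' : hT) :
  ((f, g) ^ (f', g') = (f ^ f', g ^ g'))%g.
Proof. by []. Qed.

Lemma star_lconj f g h U V :
  star (lconj (f, g) U) (lconj (g, h) V) = lconj (f, h) (star U V).
Proof.
apply/group_inj/setP=> -[x y]; rewrite mem_lconj !inE /=.
apply/existsP/existsP=> -[k].
  by rewrite !mem_conjgV !pairJg => ?; exists (k ^ g)%g.
by move=> ?; exists (k ^ g^-1)%g; rewrite !mem_conjgV !pairJg conjgKV.
Qed.

Lemma lbot_lconj f g U : lbot (lconj (f, g) U) = (lbot U :^ f^-1)%g.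
Proof. by apply/setP=> x; rewrite mem_conjgV !inE mem_lconj pairJg conj1g. Qed.

Lemma rbot_lconj f g U : rbot (lconj (f, g) U) = (rbot U :^ g^-1)%g.
Proof. by apply/setP=> x; rewrite mem_conjgV !inE mem_lconj pairJg conj1g. Qed.

Lemma ltopP U x : reflect (exists y, (x, y) \in U) (x \in ltop U).
Proof.
by apply: (iffP imsetP) => [[[x' y] /= Uxy ->]|[y Uxy]]; [exists y | exists (x, y)].
Qed.

Lemma rtopP U y : reflect (exists x, (x, y) \in U) (y \in rtop U).
Proof.
by apply: (iffP imsetP) => [[[x y'] /= Uxy ->]|[x Uxy]]; [exists x | exists (x, y)].
Qed.

Lemma ltop_lconj f g U : ltop (lconj (f, g) U) = (ltop U :^ f^-1)%g.
Proof.
apply/setP=> x; rewrite mem_conjgV; apply/ltopP/ltopP=> -[y].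
  by rewrite mem_lconj pairJg => ?; exists (y ^ g)%g.
by move=> ?; exists (y ^ g^-1)%g; rewrite mem_lconj pairJg conjgKV.
Qed.

Lemma rtop_lconj f g U : rtop (lconj (f, g) U) = (rtop U :^ g^-1)%g.
Proof.
apply/setP=> x; rewrite mem_conjgV; apply/rtopP/rtopP=> -[y].
  by rewrite mem_lconj pairJg => ?; exists (y ^ f)%g.
by move=> ?; exists (y ^ f^-1)%g; rewrite mem_lconj pairJg conjgKV.
Qed.

End SubgroupsTheory.

Definition Smor (K : fieldType) (F G : finGroupType) : lmodType K :=
  {ffun {group F * G} -> K^o}.

Section Smor.
Variables (K : fieldType) (l : nat -> K) (F G H : finGroupType).

Definition sbas (U : {group F * G}) : Smor K F G :=
  [ffun V => (V == U)%:R].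

Definition sigma (U : {group F * G}) (V : {group G * H}) : K :=
  l #|rbot U :&: lbot V|.

End Smor.
Arguments sbas K {F G} U.

Section SmorOps.
Variables (K : fieldType) (l : nat -> K) (F G H : finGroupType).

Definition Scmp (x : Smor K F G) (y : Smor K G H) : Smor K F H :=
  \sum_(U : {group F * G}) \sum_(V : {group G * H})
    ((x U : K) * (y V : K) * sigma l U V) *: sbas K (star U V).

Definition Sact (a : F * G) (x : Smor K F G) : Smor K F G :=
  \sum_(U : {group F * G}) (x U : K) *: sbas K (lconj a U).

Definition Sfixed : {pred Smor K F G} :=
  [pred x : Smor K F G | [forall a : F * G, Sact a x == x]].

Definition sbar (U : {group F * G}) : Smor K F G :=
  (#|F|%:R * #|G|%:R)^-1 *:
    \sum_(f : F) \sum_(g : G) sbas K (lconj (f, g) U).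

End SmorOps.
Arguments Sfixed {K F G}.
Arguments sbar K {F G} U.

Section SmorTheory.
Variables (K : fieldType) (F G : finGroupType).
Implicit Types (x : Smor K F G) (a : F * G).

Lemma SactE a x U : Sact a x U = x (lconj a^-1%g U).
Proof.
rewrite /Sact sum_ffunE (bigD1 (lconj a^-1%g U)) //= !ffunE lconjKV eqxx.
rewrite big1 ?addr0 => [|V neqV]; first by rewrite /GRing.scale /= mulr1.
rewrite !ffunE; case: eqP => [eqU|_]; last by rewrite scaler0.
by rewrite eqU lconjK eqxx in neqV.
Qed.

Lemma Sact_is_linear a : linear (@Sact K F G a).
Proof. by move=> c x y; apply/ffunP=> U; rewrite !(SactE, ffunE). Qed.

HB.instance Definition _ a := GRing.isLinear.Build K (Smor K F G) (Smor K F G)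
  *:%R (@Sact K F G a) (Sact_is_linear a).

Lemma Sact_sbas a U : Sact a (sbas K U) = sbas K (lconj a U).
Proof.
apply/ffunP=> V; rewrite SactE !ffunE.
by rewrite -(inj_eq (@lconj_inj _ a)) lconjKV.
Qed.

Lemma SactM a b x : Sact a (Sact b x) = Sact (a * b)%g x.
Proof. by apply/ffunP=> U; rewrite !SactE lconjM invMg. Qed.

Lemma SfixedP x : reflect (forall a, Sact a x = x) (x \in Sfixed).
Proof. exact: 'forall_eqP. Qed.

Lemma Sfixed_submod_closed : submod_closed (@Sfixed K F G).
Proof.
split=> [|c x y /SfixedP fx /SfixedP fy]; apply/SfixedP=> a.
  exact: linear0.
by rewrite linearP /= fx fy.
Qed.

HB.instance Definition _ := GRing.isSubmodClosed.Build K (Smor K F G)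
  (@Sfixed K F G) Sfixed_submod_closed.

Lemma sbarE (U : {group F * G}) :
  sbar K U = (#|F|%:R * #|G|%:R)^-1 *: \sum_(a : F * G) sbas K (lconj a U).
Proof.
congr (_ *: _); rewrite pair_bigA.
by apply: eq_bigr => -[].
Qed.

Lemma sbar_lconj a (U : {group F * G}) : sbar K (lconj a U) = sbar K U.
Proof.
rewrite !sbarE [in RHS](reindex_inj (mulIg a)).
by congr (_ *: _); apply: eq_bigr => b _; rewrite lconjM.
Qed.

Lemma sbar_fixed (U : {group F * G}) : sbar K U \in Sfixed.
Proof.
apply/SfixedP=> a; rewrite sbarE linearZ linear_sum /=; congr (_ *: _).
rewrite [RHS](reindex_inj (mulgI a)); apply: eq_bigr => b _.
by rewrite Sact_sbas lconjM.
Qed.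

End SmorTheory.

Section ScmpTheory.
Variables (K : fieldType) (l : nat -> K) (F G H : finGroupType).

Lemma Scmp_sbas (U : {group F * G}) (V : {group G * H}) :
  Scmp l (sbas K U) (sbas K V) = sigma l U V *: sbas K (star U V).
Proof.
rewrite /Scmp (bigD1 U) //= (bigD1 V) //= !ffunE !eqxx !mul1r.
rewrite !big1 ?addr0 // => [U' /negPf neqU|V' /negPf neqV].
  by apply: big1 => V' _; rewrite !ffunE neqU !mul0r scale0r.
by rewrite !ffunE neqV mulr0 mul0r scale0r.
Qed.

Lemma sigma_lconj f g h (U : {group F * G}) (V : {group G * H}) :
  sigma l (lconj (f, g) U) (lconj (g, h) V) = sigma l U V.
Proof. by rewrite /sigma rbot_lconj lbot_lconj -conjIg cardJg. Qed.

Lemma Scmp_act f g h (x : Smor K F G) (y : Smor K G H) :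
  Scmp l (Sact (f, g) x) (Sact (g, h) y) = Sact (f, h) (Scmp l x y).
Proof.
rewrite /Scmp linear_sum (reindex_inj (@lconj_inj _ (f, g))) /=.
apply: eq_bigr => U _; rewrite linear_sum (reindex_inj (@lconj_inj _ (g, h))) /=.
apply: eq_bigr => V _; rewrite linearZ /= Sact_sbas !SactE !lconjK.
by rewrite sigma_lconj star_lconj.
Qed.

Lemma Scmp_fixed (x : Smor K F G) (y : Smor K G H) :
  x \in Sfixed -> y \in Sfixed -> Scmp l x y \in Sfixed.
Proof.
move=> /SfixedP fx /SfixedP fy; apply/SfixedP=> -[f h].
by rewrite -(Scmp_act f 1%g h) fx fy.
Qed.

End ScmpTheory.

Record Sbar_mor (K : fieldType) (F G : finGroupType) := SbarMor {
  sbar_val : Smor K F G;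
  sbar_valP : sbar_val \in Sfixed
}.

HB.instance Definition _ (K : fieldType) (F G : finGroupType) :=
  [isSub for @sbar_val K F G].
HB.instance Definition _ (K : fieldType) (F G : finGroupType) :=
  [Choice of Sbar_mor K F G by <:].
HB.instance Definition _ (K : fieldType) (F G : finGroupType) :=
  [SubChoice_isSubLmodule of Sbar_mor K F G by <:].

Definition Sbar_bas (K : fieldType) (F G : finGroupType) (U : {group F * G}) :
  Sbar_mor K F G := SbarMor (sbar_fixed K U).

Definition Sbar_cmp (K : fieldType) (l : nat -> K) (F G H : finGroupType)
    (x : Sbar_mor K F G) (y : Sbar_mor K G H) : Sbar_mor K F H :=
  SbarMor (Scmp_fixed l (sbar_valP x) (sbar_valP y)).

Definition Sbar_cat (K : fieldType) (l : nat -> K) : lincat_data K :=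
  @LincatData K finGroupType (fun F G => Sbar_mor K F G)
    (fun F G H => @Sbar_cmp K l F G H) (fun G => Sbar_bas K (diag G)).

Definition sgconj (gT : finGroupType) (U : {group gT}) : {set {group gT}} :=
  [set lconj a U | a : gT].

Definition sgclass (gT : finGroupType) : predArgType :=
  {C : {set {group gT}} | C \in [set sgconj U | U : {group gT}]}.

Lemma sgconj_class (gT : finGroupType) (U : {group gT}) :
  sgconj U \in [set sgconj W | W : {group gT}].
Proof. exact: imset_f. Qed.

Definition class_of (gT : finGroupType) (U : {group gT}) : sgclass gT :=
  exist _ (sgconj U) (sgconj_class U).

Definition class_rep (gT : finGroupType) (C : sgclass gT) : {group gT} :=
  odflt 1%G [pick U in val C].

Lemma class_of_lconj (gT : finGroupType) (a : gT) (U : {group gT}) :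
  class_of (lconj a U) = class_of U.
Proof.
apply/val_inj/setP=> W /=; apply/imsetP/imsetP=> -[b _ ->].
  by exists (b * a)%g; rewrite ?lconjM.
by exists (b * a^-1)%g; rewrite ?lconjM ?mulgKV.
Qed.

Lemma class_repK (gT : finGroupType) : cancel (@class_rep gT) (@class_of gT).
Proof.
move=> C; have [U _ defC] := imsetP (valP C).
have{defC} -> : C = class_of U by apply: val_inj.
rewrite /class_rep; case: pickP => [W /imsetP[a _ ->]|/(_ U)] /=.
  exact: class_of_lconj.
by case/imsetP; exists 1%g; rewrite ?lconj1.
Qed.

Lemma class_rep_of (gT : finGroupType) (U : {group gT}) :
  exists a, class_rep (class_of U) = lconj a U.
Proof.
have: class_of (class_rep (class_of U)) = class_of U by rewrite class_repK.
move: (class_rep _) => W /(congr1 val) /= eqWU.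
have: W \in sgconj U by rewrite -eqWU; apply/imsetP; exists 1%g; rewrite ?lconj1.
by case/imsetP=> a _ ->; exists a.
Qed.

Definition Bmor (K : fieldType) (F G : finGroupType) : lmodType K :=
  {ffun sgclass (F * G)%type -> K^o}.

Definition dbas (K : fieldType) (F G : finGroupType) (U : {group F * G}) :
  Bmor K F G := [ffun C => (C == class_of U)%:R].
Arguments dbas K {F G} U.

Lemma dbas_lconj (K : fieldType) (F G : finGroupType) (a : F * G)
  (U : {group F * G}) : dbas K (lconj a U) = dbas K U.
Proof. by rewrite /dbas class_of_lconj. Qed.

Definition double_cosets (G : finGroupType) (A B : {set G}) : {set {set G}} :=
  [set (A :* g * B)%g | g : G].

Lemma sum_delta (K : fieldType) (M : lmodType K) (T : finType) (t : T)
  (f : T -> M) : \sum_i (i == t)%:R *: f i = f t.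
Proof.
rewrite (bigD1 t) //= eqxx scale1r big1 ?addr0 // => i /negPf->.
exact: scale0r.
Qed.

Lemma dcoset_conj (G : finGroupType) (A B : {set G}) (x y g : G) :
  ((A :^ x^-1) :* g * (B :^ y^-1)
    = x *: (A :* (x^-1 * g * y) * B) :* y^-1)%g.
Proof.
by rewrite !conjsgE !invgK -(mulg_set1 _ y) -(mulg_set1 _ g) !mulgA.
Qed.

Section Bcmp.
Variables (K : fieldType) (l : nat -> K) (F G H : finGroupType).
Implicit Types (U : {group F * G}) (V : {group G * H}).

Definition Bterm U V (g : G) : Bmor K F H :=
  let n := #|rbot U :&: (lbot V :^ g^-1)%g| in
  (l n / n%:R) *: dbas K (star U (lconj (g, 1%g) V)).

Definition Bcmp_bas U V : Bmor K F H :=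
  \sum_(D in double_cosets (rtop U) (ltop V)) Bterm U V (repr D).

(** By [Bcmp_dbas] and [Bcmp_bas_transversal] below, this is the bilinear map
    with [(d_U, d_V) |-> Bcmp_bas U V] for all [U] and [V], and [Bcmp_bas U V]
    does not depend on the choice of representatives of double cosets. *)
Definition Bcmp (x : Bmor K F G) (y : Bmor K G H) : Bmor K F H :=
  \sum_(C : sgclass (F * G)%type) \sum_(D : sgclass (G * H)%type)
    ((x C : K) * (y D : K)) *: Bcmp_bas (class_rep C) (class_rep D).

Lemma Bterm_lconj f x y h U V g :
  Bterm (lconj (f, x) U) (lconj (y, h) V) g = Bterm U V (x^-1 * g * y)%g.
Proof.
have eqV : lconj (g, 1%g) (lconj (y, h) V)
         = lconj (x, h) (lconj ((x^-1 * g * y)%g, 1%g) V).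
  by rewrite !lconjM !pairMg !mulgA mulgV !mul1g mulg1.
rewrite /Bterm -!(lbot_lconj _ 1%g) eqV star_lconj dbas_lconj.
by rewrite lbot_lconj rbot_lconj -conjIg cardJg.
Qed.

Lemma Bterm_dcoset U V a b g :
  a \in rtop U -> b \in ltop V -> Bterm U V (a * g * b)%g = Bterm U V g.
Proof.
case/rtopP=> f Ufa /ltopP[h Vbh].
have Ufa' : (f^-1, a^-1)%g \in U by rewrite -pairVg groupV.
rewrite -{2}(lconj_mem Ufa') -{2}(lconj_mem Vbh) Bterm_lconj.
by rewrite invgK.
Qed.

Lemma Bterm_eq U V D g g' :
    D \in double_cosets (rtop U) (ltop V) -> g \in D -> g' \in D ->
  Bterm U V g = Bterm U V g'.
Proof.
case/imsetP=> g0 _ ->.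
case/mulsgP=> _ b /rcosetP[a Ua ->] Vb ->.
case/mulsgP=> _ b' /rcosetP[a' Ua' ->] Vb' ->.
by rewrite !Bterm_dcoset.
Qed.

Lemma rtop1 U : 1%g \in rtop U.
Proof. by apply/rtopP; exists 1%g; apply: group1. Qed.

Lemma ltop1 V : 1%g \in ltop V.
Proof. by apply/ltopP; exists 1%g; apply: group1. Qed.

Lemma mem_repr_dcoset U V D :
  D \in double_cosets (rtop U) (ltop V) -> repr D \in D.
Proof.
case/imsetP=> g _ ->; apply: (mem_repr g); apply/mulsgP.
by exists g 1%g; rewrite ?mulg1 ?ltop1 //; apply/rcosetP; exists 1%g; rewrite ?mul1g ?rtop1.
Qed.

Lemma Bcmp_bas_transversal U V (r : {set G} -> G) :
    (forall D, D \in double_cosets (rtop U) (ltop V) -> r D \in D) ->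
  Bcmp_bas U V = \sum_(D in double_cosets (rtop U) (ltop V)) Bterm U V (r D).
Proof.
move=> rD; apply: eq_bigr => D dD.
by apply: (Bterm_eq dD); [apply: mem_repr_dcoset dD | apply: rD].
Qed.

Lemma Bcmp_bas_lconj a b U V : Bcmp_bas (lconj a U) (lconj b V) = Bcmp_bas U V.
Proof.
case: a b => [f x] [y h]; pose phi (D : {set G}) := (x *: D :* y^-1)%g.
have phi_inj : injective phi.
  move=> D E /(congr1 (fun X : {set G} => (x^-1 *: (X :* y)))%g).
  by rewrite /phi -!rcosetM mulVg !rcoset1 -!lcosetM mulVg !lcoset1.
have eqD : double_cosets (rtop (lconj (f, x) U)) (ltop (lconj (y, h) V))
         = phi @: double_cosets (rtop U) (ltop V).
  rewrite rtop_lconj ltop_lconj /double_cosets -imset_comp.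
  have bijg : bijective (fun g : G => x^-1 * g * y)%g.
    exists (fun g => x * g * y^-1)%g => g; first by rewrite !mulgA mulgV mul1g mulgK.
    by rewrite !mulgA mulVg mul1g mulgKV.
  have eqphi g : ((rtop U :^ x^-1) :* g * (ltop V :^ y^-1) 
      = phi (rtop U :* (x^-1 * g * y) * ltop V))%g.
    by rewrite dcoset_conj.
  apply/setP=> D; apply/imsetP/imsetP=> -[g _ ->].
    by exists (x^-1 * g * y)%g.
  by case: bijg => k _ kK; exists (k g); rewrite //= eqphi kK.
rewrite /Bcmp_bas eqD.
transitivity (\sum_(D in double_cosets (rtop U) (ltop V))
    Bterm (lconj (f, x) U) (lconj (y, h) V) (repr (phi D))).
  exact: (@big_imset _ _ _ _ _ phi _ _ (in2W phi_inj)).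
apply: eq_bigr => D dD.
rewrite Bterm_lconj.
apply: (Bterm_eq dD); last exact: mem_repr_dcoset dD.
have : repr (phi D) \in phi D.
  apply: (mem_repr (x * repr D * y^-1)%g).
  by rewrite mem_rcoset mem_lcoset invgK mulgKV mulKg (mem_repr_dcoset dD).
by rewrite mem_rcoset mem_lcoset invgK mulgA.
Qed.

Lemma Bcmp_dbas U V : Bcmp (dbas K U) (dbas K V) = Bcmp_bas U V.
Proof.
transitivity (\sum_C (C == class_of U)%:R *: \sum_D (D == class_of V)%:R *:
    Bcmp_bas (class_rep C) (class_rep D)).
  apply: eq_bigr => C _; rewrite scaler_sumr; apply: eq_bigr => D _.
  by rewrite !ffunE scalerA.
rewrite !sum_delta.
have [a ->] := class_rep_of U; have [b ->] := class_rep_of V.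
exact: Bcmp_bas_lconj.
Qed.

End Bcmp.

Definition B_cat (K : fieldType) (l : nat -> K) : lincat_data K :=
  @LincatData K finGroupType (fun F G => Bmor K F G)
    (fun F G H => @Bcmp K l F G H) (fun G => dbas K (diag G)).

Section Nu.
Variables (K : fieldType) (F G : finGroupType).

Definition nu_bas (U : {group F * G}) : Sbar_mor K F G :=
  (#|G|%:R / #|U|%:R) *: Sbar_bas K U.

Definition nu_map (x : Bmor K F G) : Sbar_mor K F G :=
  \sum_(C : sgclass (F * G)%type) (x C : K) *: nu_bas (class_rep C).

Lemma nu_map_dbas (U : {group F * G}) : nu_map (dbas K U) = nu_bas U.
Proof.
transitivity (\sum_C ((C == class_of U)%:R : K) *: nu_bas (class_rep C)).
  by apply: eq_bigr => C _; rewrite ffunE.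
rewrite sum_delta; have [a ->] := class_rep_of U.
rewrite /nu_bas card_lconj; congr (_ *: _).
by apply: val_inj; rewrite /= sbar_lconj.
Qed.

End Nu.

Definition nu (K : fieldType) (l : nat -> K) :
    functor_data (B_cat l) (Sbar_cat l) :=
  @FunctorData K (B_cat l) (Sbar_cat l) id (fun F G => @nu_map K F G).

(* Main.v *)
Require Import Defs.
From Stdlib Require Import FunctionalExtensionality.
From HB Require Import structures.
From mathcomp Require Import all_boot all_order all_algebra all_fingroup.
From mathcomp Require Import ring.
Import GRing.Theory.
Local Open Scope ring_scope.

(** Everything about the biset-style composition is transported along [nu] from
    the star product, where it is easy.

    The star product on subgroups is associative on the nose, so associativity
    of its twisted linearization is the cocycle identity for [sigma]
    ([sigma_cocycle]).  As [l] is multiplicative, this reduces to an equality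
    between products of orders: both sides count one subgroup of the middle
    factor [V], by the kernel and the image of either projection
    ([card_star_cocycle]).  Taking invariants keeps associativity, and the
    average of the conjugates of the diagonal acts as an identity on
    invariants ([Sbar_lincat]).

    The product of two averaged basis elements is itself an average, over the
    middle group [G], of star products of [U] with a conjugate of [V]
    ([Scmp_sbar]).  The composition of [d_U] and [d_V] is a sum over double
    cosets, that is, a sum over [G] in which [g] has weight the inverse of the
    order of its double coset ([Bcmp_bas_sum]).  The two agree under [nu] term by
    term because of the Mackey-type count [card_star] for [U] and a conjugate
    of [V], which comes from counting the fibre product of [U] and [V] over [G]
    through each of its two projections; the scalars in the definition of [nu]
    absorb the orders of [U], [V] and their star product ([nu_map_Bcmp_bas]).

    Finally an invariant element is the average of its own conjugates, which
    gives an explicit inverse of [nu] ([nu_invK], [nu_mapK]).  A linear,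
    multiplicative, unit-preserving map that is injective on morphisms reflects
    the axioms of a linear category ([is_lincat_reflect]). *)

Set Implicit Arguments.
Unset Strict Implicit.
Unset Printing Implicit Defensive.

(** * Counting in fibre products of groups *)

Lemma ltop_group_set (F G : finGroupType) (U : {group F * G}) :
  group_set (ltop U).
Proof.
apply/group_setP; split=> [|f f']; first exact: ltop1.
case/ltopP=> g Ug /ltopP[g' Ug']; apply/ltopP; exists (g * g')%g.
exact: (groupM Ug Ug').
Qed.

Canonical ltop_group (F G : finGroupType) (U : {group F * G}) :=
  group (ltop_group_set U).

Lemma rtop_group_set (F G : finGroupType) (U : {group F * G}) :
  group_set (rtop U).
Proof.
apply/group_setP; split=> [|g g']; first exact: rtop1.
case/rtopP=> f Uf /rtopP[f' Uf']; apply/rtopP; exists (f * f')%g.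
exact: (groupM Uf Uf').
Qed.

Canonical rtop_group (F G : finGroupType) (U : {group F * G}) :=
  group (rtop_group_set U).

(** This is the first isomorphism theorem for the first projection, whose
    kernel is a copy of [rbot U]. *)
Lemma card_ltop_rbot (F G : finGroupType) (U : {group F * G}) :
  #|U| = (#|ltop U| * #|rbot U|)%N.
Proof.
rewrite -[#|U|]sum1_card (partition_big fst (mem (ltop U))) /=; last first.
  by case=> f g Ufg; apply/ltopP; exists g.
rewrite -sum_nat_const; apply: eq_bigr => f /ltopP[g Ufg]; rewrite sum1_card.
(* the fibre over [f] is the translate of the fibre over [1] by [(f, g)] *)
have -> : #|rbot U| = #|[set ((f, g * y)%g : F * G) | y in rbot U]|.
  by rewrite card_imset // => y y' [] /mulgI.
apply: eq_card => -[x y]; rewrite unfold_in /=; apply/andP/imsetP.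
  case=> Uxy /eqP xf; rewrite {}xf in Uxy *; exists (g^-1 * y)%g.
    by rewrite inE -(mulVg f) -pairMg groupM // -pairVg groupV.
  by rewrite mulKVg.
case=> z; rewrite inE => Uz [-> ->]; rewrite eqxx; split=> //.
by rewrite -[f]mulg1 -pairMg groupM.
Qed.

Lemma card_rtop_lbot (F G : finGroupType) (U : {group F * G}) :
  #|U| = (#|rtop U| * #|lbot U|)%N.
Proof.
rewrite -[#|U|]sum1_card (partition_big snd (mem (rtop U))) /=; last first.
  by case=> f g Ufg; apply/rtopP; exists f.
rewrite -sum_nat_const; apply: eq_bigr => g /rtopP[f Ufg]; rewrite sum1_card.
have -> : #|lbot U| = #|[set ((f * x, g)%g : F * G) | x in lbot U]|.
  by rewrite card_imset // => x x' [] /mulgI.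
apply: eq_card => -[x y]; rewrite unfold_in /=; apply/andP/imsetP.
  case=> Uxy /eqP yg; rewrite {}yg in Uxy *; exists (f^-1 * x)%g.
    by rewrite inE -(mulVg g) -pairMg groupM // -pairVg groupV.
  by rewrite mulKVg.
case=> z; rewrite inE => Uz [-> ->]; rewrite eqxx; split=> //.
by rewrite -[g]mulg1 -pairMg groupM.
Qed.

Section FibreProduct.
Variables (F G H : finGroupType) (U : {group F * G}) (V : {group G * H}).

(** The fibre product of [U] and [V] over [G], with the coordinates arranged so
    that its two projections are the star product and the middle coordinate. *)
Definition fibre_set : {set (F * H) * G} :=
  [set w | ((w.1.1, w.2) \in U) && ((w.2, w.1.2) \in V)].

Lemma fibre_group_set : group_set fibre_set.
Proof.
apply/group_setP; split=> [|[[f h] g] [[f' h'] g']]; rewrite !inE /=.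
  by rewrite !group1.
case/andP=> Ufg Vgh /andP[Ufg' Vgh'].
by rewrite (groupM Ufg Ufg') (groupM Vgh Vgh').
Qed.

Canonical fibre := group fibre_group_set.

(** The fibre product maps onto [star U V] with kernel [rbot U :&: lbot V], and
    onto [rtop U :&: ltop V] with kernel [lbot U x rbot V].  Comparing the two
    counts leaves [#|rtop U :&: ltop V|], which the product formula for
    [rtop U * ltop V] turns into the third factor. *)
Lemma card_star :
  (#|rbot U :&: lbot V| * #|star U V| * #|(rtop U * ltop V)%g| = #|U| * #|V|)%N.
Proof.
have eL : ltop fibre = star U V.
  apply/setP=> -[f h]; rewrite !inE /=; apply/ltopP/existsP => -[g].
    by rewrite inE /=; exists g.
  by move=> UV; exists g; rewrite inE.
have eR : rbot fibre = rbot U :&: lbot V by apply/setP=> g; rewrite !inE.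
have eL' : lbot fibre = setX (lbot U) (rbot V).
  by apply/setP=> -[f h]; rewrite !inE.
have eR' : rtop fibre = rtop U :&: ltop V.
  apply/setP=> g; rewrite inE; apply/rtopP/andP.
    case=> -[f h]; rewrite inE /= => /andP[Ufg Vgh].
    by split; [apply/rtopP; exists f | apply/ltopP; exists h].
  case=> /rtopP[f Ufg] /ltopP[h Vgh]; exists (f, h).
  by rewrite inE /= Ufg.
have := card_ltop_rbot fibre; rewrite card_rtop_lbot eL eR eL' eR' cardsX.
move=> fibreE; rewrite [(#|rbot U :&: _| * _)%N]mulnC -fibreE.
rewrite mulnAC [(#|_ :&: _| * _)%N]mulnC -mul_cardG.
rewrite (card_rtop_lbot U) (card_ltop_rbot V).
by rewrite mulnACA.
Qed.

End FibreProduct.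

Section SigmaCocycle.
Variables (E F G H : finGroupType).
Variables (U : {group E * F}) (V : {group F * G}) (W : {group G * H}).

(** The part of [V] that [U] and [W] connect to the identity on both outer
    sides: its images and kernels under the two projections are the four
    groups whose orders enter the cocycle identity. *)
Definition middle_set : {set F * G} :=
  [set w in V | (w.1 \in rbot U) && (w.2 \in lbot W)].

Lemma middle_group_set : group_set middle_set.
Proof.
apply/group_setP; split=> [|[f g] [f' g']]; rewrite !inE /=.
  by rewrite !group1.
case/and3P=> Vfg Uf Wg /and3P[Vfg' Uf' Wg'].
rewrite (groupM Vfg Vfg').
by have := groupM Uf Uf'; have := groupM Wg Wg'; rewrite !pairMg !mulg1 => -> ->.
Qed.

Canonical middle := group middle_group_set.

Lemma card_star_cocycle :
  (#|rbot U :&: lbot V| * #|rbot (star U V) :&: lbot W|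
    = #|rbot U :&: lbot (star V W)| * #|rbot V :&: lbot W|)%N.
Proof.
have -> : rbot (star U V) :&: lbot W = rtop middle.
  apply/setP=> g; rewrite !inE /=; apply/andP/rtopP.
    by case=> /existsP[f /andP[Uf Vfg]] Wg; exists f; rewrite !inE /= Uf Vfg.
  case=> f; rewrite !inE /= => /and3P[Vfg Uf Wg]; split=> //.
  by apply/existsP; exists f; rewrite Uf.
have -> : rbot U :&: lbot (star V W) = ltop middle.
  apply/setP=> f; rewrite !inE /=; apply/andP/ltopP.
    by case=> Uf /existsP[g /andP[Vfg Wg]]; exists g; rewrite !inE /= Uf Vfg.
  case=> g; rewrite !inE /= => /and3P[Vfg Uf Wg]; split=> //.
  by apply/existsP; exists g; rewrite Vfg.
have -> : rbot U :&: lbot V = lbot middle.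
  by apply/setP=> f; rewrite !inE /= group1 andbT andbC.
have -> : rbot V :&: lbot W = rbot middle.
  by apply/setP=> g; rewrite !inE /= group1.
by rewrite mulnC -card_rtop_lbot card_ltop_rbot.
Qed.

Lemma starA : star (star U V) W = star U (star V W).
Proof.
apply/group_inj/setP=> -[e h]; rewrite !inE /=.
apply/existsP/existsP=> -[].
  move=> g /andP[]; rewrite inE /= => /existsP[f /andP[Uf Vfg]] Wg.
  by exists f; rewrite Uf inE; apply/existsP; exists g; rewrite Vfg.
move=> f /andP[Uf]; rewrite inE /= => /existsP[g /andP[Vfg Wg]].
by exists g; rewrite Wg andbT inE; apply/existsP; exists f; rewrite Uf.
Qed.

End SigmaCocycle.

Lemma cardg_neq0 (K : fieldType) (gT : finGroupType) (A : {group gT}) :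
  [pchar K] =i pred0 -> #|A|%:R != 0 :> K.
Proof. by move/pcharf0P->; rewrite -lt0n cardG_gt0. Qed.

Lemma card_finGroup_neq0 (K : fieldType) (gT : finGroupType) :
  [pchar K] =i pred0 -> #|gT|%:R != 0 :> K.
Proof. by rewrite -cardsT; apply: (cardg_neq0 [group of [set: gT]]). Qed.

(** * The linearized star product *)

Section SmorLinear.
Variables (K : fieldType) (F G : finGroupType).

Lemma sbas_expand (x : Smor K F G) : x = \sum_U (x U : K) *: sbas K U.
Proof.
apply/ffunP=> V; rewrite sum_ffunE (bigD1 V) //= !ffunE eqxx.
rewrite big1 ?addr0 => [|U neqU]; first by rewrite /GRing.scale /= mulr1.
by rewrite !ffunE eq_sym (negPf neqU) scaler0.
Qed.

Lemma linear_sbas_eq (M : lmodType K) (f g : Smor K F G -> M) :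
  linear f -> linear g -> (forall U, f (sbas K U) = g (sbas K U)) -> f =1 g.
Proof.
move=> lf lg eqfg x.
pose fL : {linear Smor K F G -> M} := HB.pack f (GRing.isLinear.Build _ _ _ _ f lf).
pose gL : {linear Smor K F G -> M} := HB.pack g (GRing.isLinear.Build _ _ _ _ g lg).
rewrite (sbas_expand x) -[f]/(fL : _ -> _) -[g]/(gL : _ -> _) !linear_sum.
by apply: eq_bigr => U _; rewrite !linearZ /= eqfg.
Qed.

End SmorLinear.

Section ScmpLinear.
Variables (K : fieldType) (l : nat -> K).

Lemma Scmp_linear_r (F G H : finGroupType) (x : Smor K F G) :
  linear (@Scmp K l F G H x).
Proof.
move=> c y y'; rewrite /Scmp scaler_sumr -big_split /=; apply: eq_bigr => U _.
rewrite scaler_sumr -big_split /=; apply: eq_bigr => V _.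
by rewrite scalerA -scalerDl !ffunE; congr (_ *: _); rewrite /GRing.scale /=; ring.
Qed.

Lemma Scmp_linear_l (F G H : finGroupType) (y : Smor K G H) :
  linear (fun x : Smor K F G => Scmp l x y).
Proof.
move=> c x x'; rewrite /Scmp scaler_sumr -big_split /=; apply: eq_bigr => U _.
rewrite scaler_sumr -big_split /=; apply: eq_bigr => V _.
by rewrite scalerA -scalerDl !ffunE; congr (_ *: _); rewrite /GRing.scale /=; ring.
Qed.

HB.instance Definition _ (F G H : finGroupType) (x : Smor K F G) :=
  GRing.isLinear.Build K (Smor K G H) (Smor K F H) *:%R (Scmp l x)
    (Scmp_linear_r x).

(** [Scmp] with the second argument fixed, named so that linearity in the first
    argument can be attached to it as a canonical structure. *)
Definition Scmpl (F G H : finGroupType) (y : Smor K G H) (x : Smor K F G) :=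
  Scmp l x y.

HB.instance Definition _ (F G H : finGroupType) (y : Smor K G H) :=
  GRing.isLinear.Build K (Smor K F G) (Smor K F H) *:%R (@Scmpl F G H y)
    (@Scmp_linear_l F G H y).

Lemma ScmpZl (F G H : finGroupType) c (x : Smor K F G) (y : Smor K G H) :
  Scmp l (c *: x) y = c *: Scmp l x y.
Proof. by rewrite -[LHS]/(Scmpl y _) linearZ. Qed.

Lemma ScmpZr (F G H : finGroupType) c (x : Smor K F G) (y : Smor K G H) :
  Scmp l x (c *: y) = c *: Scmp l x y.
Proof. by rewrite linearZ. Qed.

Lemma Scmp_suml (F G H : finGroupType) (I : finType)
    (x : I -> Smor K F G) (y : Smor K G H) :
  Scmp l (\sum_i x i) y = \sum_i Scmp l (x i) y.
Proof. by rewrite -[LHS]/(Scmpl y _) linear_sum. Qed.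

Lemma Scmp_sumr (F G H : finGroupType) (I : finType)
    (x : Smor K F G) (y : I -> Smor K G H) :
  Scmp l x (\sum_i y i) = \sum_i Scmp l x (y i).
Proof. exact: linear_sum. Qed.

Hypothesis l_hom : pos_monoid_hom l.

Lemma card_middle_gt0 (F G H : finGroupType)
    (U : {group F * G}) (V : {group G * H}) : (0 < #|rbot U :&: lbot V|)%N.
Proof. by apply/card_gt0P; exists 1%g; rewrite in_setI !in_set (group1 U) (group1 V). Qed.

Lemma sigma_cocycle (E F G H : finGroupType)
    (U : {group E * F}) (V : {group F * G}) (W : {group G * H}) :
  sigma l U V * sigma l (star U V) W = sigma l U (star V W) * sigma l V W.
Proof.
by rewrite /sigma -!(pmh_mul l_hom) ?card_star_cocycle ?card_middle_gt0.
Qed.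

Lemma ScmpA (E F G H : finGroupType)
    (x : Smor K E F) (y : Smor K F G) (z : Smor K G H) :
  Scmp l (Scmp l x y) z = Scmp l x (Scmp l y z).
Proof.
move: x; apply: linear_sbas_eq => [c x x'|c x x'|U].
- by rewrite Scmp_linear_l Scmp_linear_l.
- exact: Scmp_linear_l.
move: y; apply: linear_sbas_eq => [c y y'|c y y'|V].
- by rewrite Scmp_linear_r Scmp_linear_l.
- by rewrite Scmp_linear_l Scmp_linear_r.
move: z; apply: linear_sbas_eq => [c z z'|c z z'|W].
- exact: Scmp_linear_r.
- by rewrite !Scmp_linear_r.
rewrite !Scmp_sbas ScmpZl ScmpZr !Scmp_sbas !scalerA starA.
by rewrite sigma_cocycle [_ * sigma l V W]mulrC.
Qed.

Lemma Scmp_diag_l (F G : finGroupType) (x : Smor K F G) :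
  Scmp l (sbas K (diag F)) x = x.
Proof.
move: x; apply: linear_sbas_eq => [c x x'|c x x'|V] //; first exact: Scmp_linear_r.
rewrite Scmp_sbas (_ : star (diag F) V = V); last first.
  apply/group_inj/setP=> -[f g]; rewrite inE /=; apply/existsP/idP => [[f']|Vfg].
    by rewrite inE /= => /andP[/eqP->].
  by exists f; rewrite inE eqxx.
rewrite /sigma (_ : rbot (diag F) :&: lbot V = [set 1%g]); last first.
  apply/setP=> f; rewrite !inE /= eq_sym; case: eqP => // ->.
  by rewrite group1.
by rewrite cards1 (pmh_1 l_hom) scale1r.
Qed.

Lemma Scmp_diag_r (F G : finGroupType) (x : Smor K F G) :
  Scmp l x (sbas K (diag G)) = x.
Proof.
move: x; apply: linear_sbas_eq => [c x x'|c x x'|V] //; first exact: Scmp_linear_l.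
rewrite Scmp_sbas (_ : star V (diag G) = V); last first.
  apply/group_inj/setP=> -[f g]; rewrite inE /=; apply/existsP/idP => [[g']|Vfg].
    by case/andP=> Vf; rewrite inE /= => /eqP <-.
  by exists g; rewrite Vfg inE eqxx.
rewrite /sigma (_ : rbot V :&: lbot (diag G) = [set 1%g]); last first.
  apply/setP=> f; rewrite !inE /=; case: eqP => [->|_]; last exact: andbF.
  by rewrite group1.
by rewrite cards1 (pmh_1 l_hom) scale1r.
Qed.

End ScmpLinear.

(** * The category of invariants *)

Section Invariants.
Variables (K : fieldType) (l : nat -> K).
Hypothesis K_char0 : [pchar K] =i pred0.

(** Apply the averaging operator, which is the identity on invariants, to the
    expansion in the basis [sbas]. *)
Lemma Sfixed_avg (F G : finGroupType) (x : Smor K F G) :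
  x \in Sfixed -> x = \sum_U (x U : K) *: sbar K U.
Proof.
move=> /SfixedP fx.
have nF := card_finGroup_neq0 F K_char0; have nG := card_finGroup_neq0 G K_char0.
transitivity ((#|F|%:R * #|G|%:R)^-1 *: \sum_(a : F * G) Sact a x).
  under eq_bigr do rewrite fx.
  rewrite sumr_const card_prod -[x *+ _]scaler_nat scalerA natrM.
  by rewrite mulVf ?scale1r // mulf_neq0.
under [RHS]eq_bigr do rewrite sbarE scalerA mulrC -scalerA scaler_sumr.
by rewrite -scaler_sumr exchange_big.
Qed.

(** After simultaneous conjugation, only the relative position of the two
    conjugating elements of [G] matters; hence one of the two sums over [G]
    just cancels one factor [#|G|]. *)
Lemma Scmp_sbar (F G H : finGroupType) (U : {group F * G}) (V : {group G * H}) :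
  Scmp l (sbar K U) (sbar K V)
    = #|G|%:R^-1 *: \sum_(g : G) sigma l U (lconj (g, 1%g) V)
        *: sbar K (star U (lconj (g, 1%g) V)).
Proof.
have nF := card_finGroup_neq0 F K_char0; have nG := card_finGroup_neq0 G K_char0.
have nH := card_finGroup_neq0 H K_char0.
pose T (g : G) (f : F) (h : H) := sigma l U (lconj (g, 1%g) V)
  *: sbas K (lconj (f, h) (star U (lconj (g, 1%g) V))).
have TE f g g' h :
  Scmp l (sbas K (lconj (f, g) U)) (sbas K (lconj (g * g', h)%g V)) = T g' f h.
  have -> : (g * g', h)%g = ((g, h) * (g', 1))%g by rewrite pairMg mulg1.
  by rewrite -lconjM Scmp_sbas sigma_lconj star_lconj.
rewrite /sbar ScmpZl ScmpZr Scmp_suml.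
have -> : \sum_f Scmp l (\sum_g sbas K (lconj (f, g) U))
              (\sum_g \sum_h sbas K (lconj (g, h) V))
        = #|G|%:R *: \sum_g \sum_f \sum_h T g f h.
  rewrite [in RHS]exchange_big /= scaler_sumr; apply: eq_bigr => f _.
  (* [g * g'] runs over [G] for each [g], and [T] depends on [g'] only *)
  rewrite Scmp_suml -[_ *: _]/(#|G|%:R *: _) scaler_nat -sumr_const.
  apply: eq_bigr => g _; rewrite Scmp_sumr (reindex_inj (mulgI g)) /=.
  apply: eq_bigr => g' _; rewrite Scmp_sumr; apply: eq_bigr => h _.
  exact: TE.
rewrite !scalerA !scaler_sumr; apply: eq_bigr => g _.
under eq_bigr do rewrite -scaler_sumr.
rewrite -scaler_sumr !scalerA; congr (_ *: _); field.
by rewrite nF nG nH.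
Qed.

Hypothesis l_hom : pos_monoid_hom l.

(** Each conjugate of the diagonal sends an invariant [x] to itself: move the
    conjugation of the middle coordinate over to [x], which absorbs it. *)
Lemma Scmp_sbar_diag_l (F G : finGroupType) (x : Smor K F G) :
  x \in Sfixed -> Scmp l (sbar K (diag F)) x = x.
Proof.
move=> /SfixedP fx; have nF := card_finGroup_neq0 F K_char0.
rewrite sbarE ScmpZl Scmp_suml (eq_bigr (fun _ => x)) => [|[f g] _].
  rewrite sumr_const card_prod -[x *+ _]scaler_nat scalerA natrM.
  by rewrite mulVf ?scale1r // mulf_neq0.
by rewrite -Sact_sbas -{1}(fx (g, 1%g)) Scmp_act Scmp_diag_l.
Qed.

Lemma Scmp_sbar_diag_r (F G : finGroupType) (x : Smor K F G) :
  x \in Sfixed -> Scmp l x (sbar K (diag G)) = x.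
Proof.
move=> /SfixedP fx; have nG := card_finGroup_neq0 G K_char0.
rewrite sbarE ScmpZr Scmp_sumr (eq_bigr (fun _ => x)) => [|[f g] _].
  rewrite sumr_const card_prod -[x *+ _]scaler_nat scalerA natrM.
  by rewrite mulVf ?scale1r // mulf_neq0.
by rewrite -Sact_sbas -{1}(fx (1%g, f)) Scmp_act Scmp_diag_r.
Qed.

Lemma Sbar_lincat : is_lincat (Sbar_cat l).
Proof.
split=> [E F G H x y z|F G x|F G x|F G H y c x x'|F G H x c y y'];
  apply: val_inj => /=.
- exact: ScmpA.
- exact/Scmp_sbar_diag_l/sbar_valP.
- exact/Scmp_sbar_diag_r/sbar_valP.
- exact: Scmp_linear_l.
- exact: Scmp_linear_r.
Qed.

End Invariants.

(** * The comparison map *)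

Section Nu.
Variables (K : fieldType) (F G : finGroupType).

Lemma dbas_expand (x : Bmor K F G) :
  x = \sum_C (x C : K) *: dbas K (class_rep C).
Proof.
apply/ffunP=> C; rewrite sum_ffunE -(sum_delta C (x : _ -> K^o)).
apply: eq_bigr => D _; rewrite !ffunE class_repK eq_sym.
by rewrite /GRing.scale /= mulrC.
Qed.

Lemma sbar_val_linear : linear (@sbar_val K F G).
Proof. by []. Qed.

HB.instance Definition _ := GRing.isLinear.Build K (Sbar_mor K F G) (Smor K F G)
  *:%R (@sbar_val K F G) sbar_val_linear.

Lemma sbar_valZ c (x : Sbar_mor K F G) : sbar_val (c *: x) = c *: sbar_val x.
Proof. by []. Qed.

Lemma sbar_val_sum (I : finType) (P : pred I) (x : I -> Sbar_mor K F G) :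
  sbar_val (\sum_(i | P i) x i) = \sum_(i | P i) sbar_val (x i).
Proof. exact: linear_sum. Qed.

Lemma sbar_val_nu_map (x : Bmor K F G) : sbar_val (nu_map x)
  = \sum_C ((x C : K) * (#|G|%:R / #|class_rep C|%:R)) *: sbar K (class_rep C).
Proof.
rewrite /nu_map sbar_val_sum; apply: eq_bigr => C _.
by rewrite sbar_valZ sbar_valZ scalerA.
Qed.

Lemma nu_map_is_linear : linear (@nu_map K F G).
Proof.
move=> c x y; apply: val_inj; rewrite /= [RHS]sbar_val_linear !sbar_val_nu_map.
rewrite scaler_sumr -big_split /=; apply: eq_bigr => C _.
have -> : (c *: x + y) C = c * x C + y C :> K by rewrite !ffunE.
by rewrite mulrDl scalerDl -mulrA -scalerA.
Qed.

HB.instance Definition _ := GRing.isLinear.Build K (Bmor K F G) (Sbar_mor K F G)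
  *:%R (@nu_map K F G) nu_map_is_linear.

Lemma nu_mapZ c (x : Bmor K F G) : nu_map (c *: x) = c *: nu_map x.
Proof. by rewrite linearZ. Qed.

Lemma nu_map_sum (I : finType) (P : pred I) (x : I -> Bmor K F G) :
  nu_map (\sum_(i | P i) x i) = \sum_(i | P i) nu_map (x i).
Proof. exact: linear_sum. Qed.

(** The inverse of [nu], extended to all of [Smor] where it can be evaluated on
    the basis [sbas]; there it identifies conjugate subgroups. *)
Definition nu_inv_raw (x : Smor K F G) : Bmor K F G :=
  \sum_U ((x U : K) * (#|U|%:R / #|G|%:R)) *: dbas K U.

Lemma nu_inv_raw_is_linear : linear nu_inv_raw.
Proof.
move=> c x y; rewrite /nu_inv_raw scaler_sumr -big_split /=.
apply: eq_bigr => U _.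
have -> : (c *: x + y) U = c * x U + y U :> K by rewrite !ffunE.
by rewrite mulrDl scalerDl -mulrA -scalerA.
Qed.

HB.instance Definition _ := GRing.isLinear.Build K (Smor K F G) (Bmor K F G)
  *:%R nu_inv_raw nu_inv_raw_is_linear.

Lemma nu_inv_raw_sbas (U : {group F * G}) :
  nu_inv_raw (sbas K U) = (#|U|%:R / #|G|%:R) *: dbas K U.
Proof.
rewrite /nu_inv_raw (bigD1 U) //= ffunE eqxx mul1r big1 ?addr0 // => V neqV.
by rewrite ffunE (negPf neqV) mul0r scale0r.
Qed.

Definition nu_inv (x : Sbar_mor K F G) : Bmor K F G := nu_inv_raw (sbar_val x).

Lemma nu_inv_is_linear : linear nu_inv.
Proof. by move=> c x y; rewrite /nu_inv -linearP. Qed.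

Hypothesis K_char0 : [pchar K] =i pred0.

(** Each [d_U] receives the scalar by which [nu] must be divided, so the
    composite is the average of an invariant over its conjugates. *)
Lemma nu_invK : cancel nu_inv (@nu_map K F G).
Proof.
have nG := card_finGroup_neq0 G K_char0.
move=> x; rewrite /nu_inv /nu_inv_raw linear_sum.
apply: val_inj; rewrite /= [RHS](Sfixed_avg K_char0 (sbar_valP x)).
rewrite sbar_val_sum.
apply: eq_bigr => U _; have nU := cardg_neq0 U K_char0.
rewrite linearZ /= nu_map_dbas /nu_bas scalerA /=.
congr (_ *: _); field; exact/andP.
Qed.

(** All the conjugates averaged in [sbar U] have the same image under
    [nu_inv_raw]. *)
Lemma nu_mapK : cancel (@nu_map K F G) nu_inv.
Proof.
have nF := card_finGroup_neq0 F K_char0; have nG := card_finGroup_neq0 G K_char0.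
move=> x; rewrite [RHS]dbas_expand /nu_inv /nu_map.
rewrite sbar_val_sum linear_sum /=.
apply: eq_bigr => C _; set U := class_rep C.
have nU := cardg_neq0 U K_char0.
rewrite linearZ sbarE !linearZ linear_sum /=.
have -> : \sum_a nu_inv_raw (sbas K (lconj a U))
        = (#|F|%:R * #|G|%:R * (#|U|%:R / #|G|%:R)) *: dbas K U.
  under eq_bigr => a _ do rewrite nu_inv_raw_sbas dbas_lconj card_lconj.
  by rewrite sumr_const card_prod -[_ *+ _]scaler_nat scalerA natrM.
rewrite !scalerA; congr (_ *: _); field.
by rewrite nF nG nU.
Qed.

End Nu.

Section NuMultiplicative.
Variables (K : fieldType) (l : nat -> K).
Hypothesis K_char0 : [pchar K] =i pred0.
Variables (F G H : finGroupType).

(** Spreading each double coset over its elements gives a sum over [G] that can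
    be compared with [Scmp_sbar] term by term. *)
Lemma Bcmp_bas_sum (U : {group F * G}) (V : {group G * H}) :
  Bcmp_bas l U V
    = \sum_(g : G) #|(rtop U :* g * ltop V)%g|%:R^-1 *: Bterm l U V g.
Proof.
pose dc (g : G) := (rtop U :* g * ltop V)%g.
have dc_refl g : g \in dc g.
  apply/mulsgP; exists g 1%g; rewrite ?mulg1 ?ltop1 //.
  by apply/rcosetP; exists 1%g; rewrite ?mul1g ?rtop1.
have dc_eq g g' : (dc g' == dc g) = (g' \in dc g).
  apply/eqP/idP => [<- //|/mulsgP[_ b /rcosetP[a Ua ->] Vb ->]].
  rewrite /dc rcosetM -mulgA lcoset_id // rcosetM.
  by rewrite rcoset_id.
rewrite [RHS](partition_big dc [in double_cosets (rtop U) (ltop V)]) /=; last first.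
  by move=> g _; apply: imset_f.
apply: eq_bigr => D dD; have /imsetP[g0 _ defD] := dD.
have nD : #|D|%:R != 0 :> K.
  have /pcharf0P-> := K_char0; rewrite -lt0n defD; apply/card_gt0P.
  by exists g0; apply: dc_refl.
transitivity (\sum_(g in D) #|D|%:R^-1 *: Bterm l U V (repr D)).
  by rewrite sumr_const -[_ *+ _]scaler_nat scalerA mulfV ?scale1r.
apply: eq_big => [g|g Dg]; first by rewrite defD dc_eq.
have -> : (rtop U :* g * ltop V)%g = D.
  by apply/eqP; move: Dg; rewrite defD -dc_eq.
by rewrite (Bterm_eq l dD (mem_repr_dcoset dD) Dg).
Qed.

(** The [g]-terms on both sides are multiples of the same basis element, and
    their scalars agree by [card_star] for [U] and the conjugate of [V]. *)
Lemma nu_map_Bcmp_bas (U : {group F * G}) (V : {group G * H}) :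
  nu_map (Bcmp_bas l U V) = Sbar_cmp l (nu_bas K U) (nu_bas K V).
Proof.
have nF := card_finGroup_neq0 F K_char0; have nG := card_finGroup_neq0 G K_char0.
have nH := card_finGroup_neq0 H K_char0.
have nU := cardg_neq0 U K_char0; have nV := cardg_neq0 V K_char0.
apply: val_inj; rewrite /= ScmpZl ScmpZr Scmp_sbar //.
rewrite Bcmp_bas_sum nu_map_sum sbar_val_sum !scaler_sumr.
apply: eq_bigr => g _; set W := lconj (g, 1%g) V.
rewrite /Bterm !nu_mapZ nu_map_dbas /nu_bas !sbar_valZ !scalerA.
congr (_ *: _).
rewrite -(lbot_lconj g 1%g) -/W /sigma; set n := #|_ :&: _|.
(* the double coset of [g] is a translate of [rtop U * ltop W] *)
have cardE : (n * #|star U W| * #|(rtop U :* g * ltop V)%g| = #|U| * #|V|)%N.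
  rewrite -(card_lconj (g, 1%g) V) -card_star -/n ltop_lconj; congr (_ * _)%N.
  by rewrite conjsgE invgK !mulgA card_rcoset.
have /pcharf0P char0 := K_char0.
have: (#|U| * #|V|)%:R != 0 :> K by rewrite natrM mulf_neq0.
rewrite -cardE !natrM !mulf_eq0 !negb_or => /andP[/andP[nn nS] nD].
have {}cardE := congr1 (fun m => m%:R : K) cardE; rewrite /= !natrM in cardE.
have -> : #|U|%:R = n%:R * #|star U W|%:R * #|(rtop U :* g * ltop V)%g|%:R
                    / #|V|%:R :> K by rewrite cardE mulfK.
by field; rewrite nn nS nD nV nF nG nH.
Qed.

Lemma nu_map_Bcmp (x : Bmor K F G) (y : Bmor K G H) :
  nu_map (Bcmp l x y) = Sbar_cmp l (nu_map x) (nu_map y).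
Proof.
apply: val_inj; rewrite /Bcmp nu_map_sum /= sbar_val_sum.
rewrite [in RHS]/nu_map !sbar_val_sum Scmp_suml; apply: eq_bigr => C _.
rewrite nu_map_sum sbar_val_sum Scmp_sumr; apply: eq_bigr => D _.
by rewrite nu_mapZ nu_map_Bcmp_bas !sbar_valZ ScmpZl ScmpZr scalerA.
Qed.

End NuMultiplicative.

Lemma nu_map_diag (K : fieldType) (G : finGroupType) :
  [pchar K] =i pred0 -> nu_map (dbas K (diag G)) = Sbar_bas K (diag G).
Proof.
move=> K_char0; rewrite nu_map_dbas /nu_bas.
have -> : #|diag G| = #|G|.
  rewrite -cardsT -(card_imset [set: G] (f := fun g => (g, g))); last first.
    by move=> g g' [].
  apply: eq_card => -[g g']; rewrite inE; apply/eqP/imsetP => /= [->|[k _ [-> ->]] //].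
  by exists g'.
by rewrite mulfV ?scale1r // card_finGroup_neq0.
Qed.

(** * Transport of structure *)

(** Each axiom is an equation between morphisms, and may be checked after
    applying [T]. *)
Lemma is_lincat_reflect (K : fieldType) (C D : lincat_data K)
    (T : functor_data C D) :
    is_linfunctor T -> (forall F G : obj C, injective (@fmor K C D T F G)) ->
  is_lincat D -> is_lincat C.
Proof.
move=> [Tlin Tcmp Tid] Tinj [DA D1l D1r Dlinl Dlinr].
split=> [E F G H x y z|F G x|F G x|F G H y c x x'|F G H x c y y']; apply: Tinj.
- by rewrite !Tcmp DA.
- by rewrite Tcmp Tid D1l.
- by rewrite Tcmp Tid D1r.
- by rewrite Tlin !Tcmp Tlin Dlinl.
- by rewrite Tlin !Tcmp Tlin Dlinr.
Qed.

Theorem theorem9p3 (K : fieldType) (K_char0 : [pchar K] =i pred0)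
    (l : nat -> K) (l_hom : pos_monoid_hom l) :
  [/\ cmp_associative (B_cat l),
      is_lincat (B_cat l),
      is_lincat_iso (nu l)
    & forall G : finGroupType, fobj (nu l) G = G].
Proof.
have Dcat : is_lincat (Sbar_cat l) by exact: Sbar_lincat.
have nuP : is_linfunctor (nu l).
  split=> [F G|F G H x y|G]; first exact: nu_map_is_linear.
    exact: nu_map_Bcmp.
  exact: nu_map_diag.
have Bcat : is_lincat (B_cat l).
  by apply: (is_lincat_reflect nuP) => // F G; exact: can_inj (nu_mapK K_char0).
split=> //; first exact: lincat_assoc Bcat.
split=> //.
pose S := @FunctorData K (Sbar_cat l) (B_cat l) id (fun F G => @nu_inv K F G).
exists S; split.
- split=> [F G|F G H x y|G]; first exact: nu_inv_is_linear.
    apply: (can_inj (nu_mapK K_char0)) => /=.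
    by rewrite nu_map_Bcmp // !nu_invK.
  by apply: (can_inj (nu_mapK K_char0)); rewrite /= nu_map_diag // nu_invK.
- congr FunctorData; do 3![apply: functional_extensionality_dep => ?].
  exact: nu_mapK.
- congr FunctorData; do 3![apply: functional_extensionality_dep => ?].
  exact: nu_invK.
Qed.
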